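(* Let $n=2m$ with $n\ge4$, let $S\subseteq D_n$ be non-empty with $1\notin S$ and $S=S^{-1}$, and suppose that $\mathrm{Cay}(D_n,S)$ is normal. Then $\mathrm{Cay}(D_n,S)$ exhibits PST between the vertices $u$ and $v$ at time $\tau$ if and only if $(u,v)\in(G_0\times G_0)\cup(G_1\times G_1)$ with $u-v=\pm m$, and the eigenvalues of the discriminant matrix $P$ satisfy (i) $T_\tau(\widetilde\mu_1)=T_\tau(\widetilde\mu_2)=1$, $T_\tau(\widetilde\mu_3)=T_\tau(\widetilde\mu_4)=(-1)^m$; and (ii) $T_\tau(\mu_h)=(-1)^h$ for $1\le h\le m-1$.
   Context: Grover walk and PST. For a finite simple graph $G$, let $\mathcal{A}(G)=\{(u,v),(v,u):\{u,v\}\in E(G)\}$ be the set of arcs; for $a=(u,v)$ put $t(a)=v$ and $\bar a=(v,u)$. The shift matrix $R\in\mathbb{C}^{\mathcal{A}(G)\times\mathcal{A}(G)}$ has $R_{a,b}=1$ if $a=\bar b$ and $0$ otherwise. The boundary matrix $N\in\mathbb{C}^{V(G)\times\mathcal{A}(G)}$ has $N_{u,a}=1/\sqrt{\deg u}$ if $t(a)=u$ and $0$ otherwise. The transition matrix of the Grover walk is $U=R(2N^*N-I)$. The discriminant is $P=NRN^*$, which for a $k$-regular graph equals $\frac1k A$ with $A$ the adjacency matrix. For a vertex $u$, $\Phi_u=N^*\mathbf{e}_u$. $G$ exhibits perfect state transfer (PST) from $u$ to another vertex $v\ne u$ at time $\tau$ ($\tau$ a positive integer) if $U^\tau\Phi_u=\gamma\Phi_v$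 for some $\gamma\in\mathbb{C}$ with $|\gamma|=1$; this relation is symmetric in $u,v$, so one says PST between $u$ and $v$. $T_k$ is the Chebyshev polynomial of the first kind. Dihedral Cayley graphs. $D_n=\langle a,b:a^n=1=b^2,\ bab=a^{-1}\rangle$ has order $2n$; $\omega_n=e^{2\pi\sqrt{-1}/n}$. $\mathrm{Cay}(D_n,S)$ has vertex set $D_n$ and edges $\{x,y\}$ with $xy^{-1}\in S$; it is normal if $S$ is a union of conjugacy classes of $D_n$. Vertices are labelled by integers: $u\in G_0:=\{0,\ldots,n-1\}$ stands for $a^u$, and $u\in G_1:=\{n,\ldots,2n-1\}$ stands for $ba^{u-n}$. Let $d=|S|$, $S_1=S\cap\langle a\rangle$, $S_2=bS\cap\langle a\rangle$ with $bS=\{bs:s\in S\}$, $s_i=|S_i|$; $d_{i,0}$ (resp. $d_{i,1}$) is the number of $a^k\in S_i$, $0\le k\le n-1$, with $k$ even (resp. odd), $i=1,2$. For $C\subseteq\langle a\rangle$, $\eta_h(C)=\sum_{0\le k\le n-1,\ a^k\in C}\omega_n^{hk}$ (zero if $C=\emptyset$). In the normal case $\eta_h(S_2)=0$ for all $1\le h\le m-1$, and the eigenvalues of $P$ are: $\widetilde\mu_1=1$, $\widetilde\mu_2=(s_1-s_2)/d$, $\widetilde\mu_3=(d_{1,0}-d_{1,1}+d_{2,0}-d_{2,1})/d$, $\widetilde\mu_4=(d_{1,0}-d_{1,1}+d_{2,1}-d_{2,0})/d$, and $\mu_h=\eta_h(S_1)/d$ for $1\le h\le m-1$. *)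

(* Defs.v *)
From HB Require Import structures.
From mathcomp Require Import all_boot all_order all_algebra all_fingroup.
From mathcomp Require Import cyclic.
From mathcomp Require Import reals trigo.
From mathcomp Require Import complex.

Set Implicit Arguments.
Unset Strict Implicit.
Unset Printing Implicit Defensive.
Import Order.TTheory GRing.Theory Num.Theory.

Local Open Scope ring_scope.
Local Open Scope sesquilinear_scope.

(** Grover walks. A finite simple graph on [V] is given by its adjacency
    relation, symmetric and irreflexive; its arcs are the ordered pairs of
    adjacent vertices. Matrices indexed by vertices or by arcs use the
    enumerations of [V] and of [arcs e]. *)

Definition arcs (V : finType) (e : rel V) : {set V * V} :=
  [set x : V * V | e x.1 x.2].

Definition arc_at (V : finType) (e : rel V) (i : 'I_#|arcs e|) : V * V :=
  enum_val i.

Definition arc_rev (V : finType) (x : V * V) : V * V := (x.2, x.1).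

Definition deg (V : finType) (e : rel V) (u : V) : nat := #|[set v | e u v]|.

Definition shift_mx (C : numClosedFieldType) (V : finType) (e : rel V) :
    'M[C]_#|arcs e| :=
  \matrix_(i, j) (if arc_at i == arc_rev (arc_at j) then 1 else 0).

Definition boundary_mx (C : numClosedFieldType) (V : finType) (e : rel V) :
    'M[C]_(#|V|, #|arcs e|) :=
  \matrix_(i, j) (if (arc_at j).2 == enum_val i
                  then 1 / sqrtC (deg e (enum_val i))%:R else 0).

Definition grover_mx (C : numClosedFieldType) (V : finType) (e : rel V) :
    'M[C]_#|arcs e| :=
  shift_mx C e *m (2 *: ((boundary_mx C e)^t* *m boundary_mx C e) - 1%:M).

Definition discriminant_mx (C : numClosedFieldType) (V : finType) (e : rel V) :
    'M[C]_#|V| :=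
  boundary_mx C e *m shift_mx C e *m (boundary_mx C e)^t*.

Definition vertex_state (C : numClosedFieldType) (V : finType) (e : rel V)
    (u : V) : 'cV[C]_#|arcs e| :=
  (boundary_mx C e)^t* *m delta_mx (enum_rank u) 0.

Definition pst (C : numClosedFieldType) (V : finType) (e : rel V) (u v : V)
    (tau : nat) : Prop :=
  [/\ v != u, (0 < tau)%N
    & exists2 gamma : C, `|gamma| = 1
      & (grover_mx C e) ^+ tau *m vertex_state C e u
        = gamma *: vertex_state C e v].

Fixpoint chebyshev_pair (A : nzRingType) (k : nat) : {poly A} * {poly A} :=
  if k is k'.+1 then
    let: (p, q) := chebyshev_pair A k' in (q, 'X *+ 2 * q - p)
  else (1, 'X).

(** The Chebyshev polynomial of the first kind: [T_0 = 1], [T_1 = X],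
    [T_(k+2) = 2 X T_(k+1) - T_k]; the pair above is [(T_k, T_(k+1))]. *)
Definition chebyshev (A : nzRingType) (k : nat) : {poly A} :=
  (chebyshev_pair A k).1.

(** Dihedral groups. A finite group generated by [a] and [b] that satisfy the
    relations of [D_n] is a quotient of [D_n], so it is [D_n] exactly when its
    order is [2n]. *)

Definition dihedral_pres (gT : finGroupType) (n : nat) (a b : gT) : Prop :=
  [/\ <<[set a; b]>>%g = [set: gT], #|gT| = (2 * n)%N,
      (a ^+ n = 1)%g, (b ^+ 2 = 1)%g & (b * a * b = a^-1)%g].

Definition cayley (gT : finGroupType) (S : {set gT}) : rel gT :=
  fun x y => (x * y^-1)%g \in S.

(** [Cay(D_n, S)] is normal when [S] is a union of conjugacy classes. *)
Definition normal_connection_set (gT : finGroupType) (S : {set gT}) : Prop :=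
  exists2 K : {set {set gT}}, K \subset classes [set: gT] & S = cover K.

(** The vertex with integer label [u], for [0 <= u <= 2n - 1]. *)
Definition dihedral_vertex (gT : finGroupType) (n : nat) (a b : gT)
    (u : 'I_(2 * n)) : gT :=
  if (u < n)%N then (a ^+ u)%g else (b * a ^+ (u - n))%g.

(** [S_1] and [S_2]: as [b] is an involution, [reflections] is the set of the
    rotations [a^k] such that [b a^k] is in [S]. *)
Definition rotations (gT : finGroupType) (a : gT) (S : {set gT}) : {set gT} :=
  S :&: <[a]>%g.

Definition reflections (gT : finGroupType) (a b : gT) (S : {set gT}) :
    {set gT} :=
  (b *: S)%g :&: <[a]>%g.

Definition even_count (gT : finGroupType) (n : nat) (a : gT) (X : {set gT}) :
    nat :=
  #|[set k : 'I_n | ((a ^+ k)%g \in X) && ~~ odd k]|.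

Definition odd_count (gT : finGroupType) (n : nat) (a : gT) (X : {set gT}) :
    nat :=
  #|[set k : 'I_n | ((a ^+ k)%g \in X) && odd k]|.

(** [exp(2 pi i / n)] *)
Definition omega (R : realType) (n : nat) : R[i] :=
  Complex (cos (2 * pi / n%:R)) (sin (2 * pi / n%:R)).

Definition eta_sum (R : realType) (gT : finGroupType) (n : nat) (a : gT) (h : nat)
    (X : {set gT}) : R[i] :=
  \sum_(k < n | (a ^+ k)%g \in X) omega R n ^+ (h * k).

(** The eigenvalues of the discriminant of a normal Cayley graph of [D_n],
    [n = 2m]: [mut1], ..., [mut4] come from the four linear characters and
    [mu h], [1 <= h <= m - 1], from the characters of degree two. The lemma
    [discriminant_eigenvalues] below shows that they are exactly the
    eigenvalues of [discriminant_mx]. *)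

Definition mut1 (R : realType) : R[i] := 1.

Definition mut2 (R : realType) (gT : finGroupType) (a b : gT) (S : {set gT}) :
    R[i] :=
  (#|rotations a S|%:R - #|reflections a b S|%:R) / #|S|%:R.

Definition mut3 (R : realType) (gT : finGroupType) (n : nat) (a b : gT)
    (S : {set gT}) : R[i] :=
  ((even_count n a (rotations a S))%:R - (odd_count n a (rotations a S))%:R
   + (even_count n a (reflections a b S))%:R
   - (odd_count n a (reflections a b S))%:R) / #|S|%:R.

Definition mut4 (R : realType) (gT : finGroupType) (n : nat) (a b : gT)
    (S : {set gT}) : R[i] :=
  ((even_count n a (rotations a S))%:R - (odd_count n a (rotations a S))%:R
   + (odd_count n a (reflections a b S))%:R
   - (even_count n a (reflections a b S))%:R) / #|S|%:R.

Definition mu (R : realType) (gT : finGroupType) (n : nat) (a : gT)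
    (S : {set gT}) (h : nat) : R[i] :=
  eta_sum R n a h (rotations a S) / #|S|%:R.

Module DihedralSpectrum.
Section Spectrum.
Variable R : realType.

Lemma omegaX n k : omega R n ^+ k =
  Complex (cos (k%:R * (2 * pi / n%:R))) (sin (k%:R * (2 * pi / n%:R))).
Proof.
rewrite /omega; set t := 2 * pi / n%:R.
elim: k => [|k IHk]; first by rewrite expr0 mul0r cos0 sin0.
rewrite exprS IHk -natr1 mulrDl mul1r [_ + t]addrC cosD sinD.
by apply/eqP; rewrite eq_complex /= eqxx addrC eqxx.
Qed.

Lemma omega_prim n : (0 < n)%N -> n.-primitive_root (omega R n).
Proof.
move=> n0; rewrite /primitive_root_of_unity n0; apply/forallP => i.
have n0R : (n%:R : R) != 0 by rewrite pnatr_eq0 -lt0n.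
rewrite unity_rootE omegaX; apply/eqP.
have [->|ne] := eqVneq i.+1 n.
  by rewrite mulrCA divff // mulr1 mulrC mulr_natr cos2pi sin2pi; apply/eqP.
have lt_in : (i.+1 < n)%N by rewrite ltn_neqAle ne ltn_ord.
apply/negbTE; rewrite eq_complex /= negb_and; apply/orP; left.
pose x : R := pi * i.+1%:R / n%:R.
have -> : i.+1%:R * (2 * pi / n%:R) = x + x :> R.
  by rewrite /x -mulr2n -[RHS]mulr_natl !mulrA [i.+1%:R * 2]mulrC -!mulrA
    [i.+1%:R * _]mulrCA.
have x0 : 0 < x by rewrite /x divr_gt0 ?mulr_gt0 ?pi_gt0 ?ltr0n.
have xpi : x < pi.
  by rewrite /x ltr_pdivrMr ?ltr0n // ltr_pM2l ?pi_gt0 // ltr_nat.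
have s0 : 0 < sin x by apply: sin_gt0_pi; rewrite x0.
rewrite cosD -!expr2; have := cos2Dsin2 x => /(canRL (addrK _)) ->.
by rewrite lt_eqF // -addrA gtrDl -opprD oppr_lt0 addr_gt0 // exprn_gt0.
Qed.

Lemma dft_inj n (F : 'I_n -> R[i]) :
    (forall h : 'I_n, \sum_k F k * omega R n ^+ (h * k) = 0) ->
  forall k, F k = 0.
Proof.
move=> F0 k; have n0 : (0 < n)%N by case: n k {F F0} => [[]|].
set p : {poly R[i]} := \poly_(i < n) (if insub i is Some j then F j else 0).
have Fp i : p`_(nat_of_ord i) = F i by rewrite coef_poly ltn_ord valK.
have -> : F k = p`_k by [].
rewrite (_ : p = 0) ?coef0 //.
apply: (@roots_geq_poly_eq0 _ p [seq omega R n ^+ i | i <- iota 0 n]).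
- apply/allP => _ /mapP[h + ->]; rewrite mem_iota add0n => /= hn.
  rewrite rootE horner_poly -[X in _ == X](F0 (Ordinal hn)); apply/eqP.
  by apply: eq_bigr => i _; rewrite valK exprM.
- rewrite map_inj_in_uniq ?iota_uniq // => i j; rewrite !mem_iota !add0n => hi hj.
  move/eqP; rewrite (eq_prim_root_expr (omega_prim n0)) !modn_small //.
  by move/eqP.
- by rewrite size_map size_iota size_poly.
Qed.

Variables (n : nat) (gT : finGroupType) (a b : gT).
Hypothesis n0 : (0 < n)%N.
Hypothesis hD : dihedral_pres n a b.
Local Open Scope group_scope.

Lemma bV : b^-1 = b.
Proof. by case: hD => _ _ _ b2 _; apply/eqP; rewrite eq_invg_mul -[b * b]/(b ^+ 2) b2. Qed.

Lemma ab : a ^ b = a^-1.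
Proof. by case: hD => _ _ _ _ <-; rewrite conjgE bV mulgA. Qed.

Lemma dih_struct : #[a] = n /\ b \notin <[a]>.
Proof.
case: hD => gen cG an b2 _.
have nab : <[b]> \subset 'N(<[a]>).
  by rewrite cycle_subG; apply/normP; rewrite -cycleJ ab cycleV.
have defG : <[a]> * <[b]> = [set: gT].
  by rewrite -norm_joinEr // -gen /cycle joing_idl joing_idr.
have bn : b \notin <[a]>.
  apply/negP => ba; move: defG; rewrite mulGSid ?cycle_subG // => E.
  have : (#|<[a]>| <= n)%N by rewrite dvdn_leq // order_dvdn an.
  by rewrite E cardsT cG mul2n -addnn -[X in (_ <= X)%N]addn0 leq_add2l leqNgt n0.
split=> //; apply/eqP; rewrite eqn_leq dvdn_leq //=; last first.
  by rewrite order_dvdn an.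
have ob : (#[b] <= 2)%N by rewrite dvdn_leq // order_dvdn b2.
have := mul_cardG <[a]> <[b]>; rewrite defG cardsT cG -!orderE => E.
rewrite -(leq_pmul2l (isT : 0 < 2)%N).
apply: leq_trans (_ : #[a] * #[b] <= _)%N; last by rewrite mulnC leq_mul2r ob orbT.
by rewrite E leq_pmulr // cardG_gt0.
Qed.

Lemma a_eq i j : (a ^+ i == a ^+ j) = (i == j %[mod n]).
Proof. by rewrite eq_expg_mod_order dih_struct.1. Qed.

Lemma ab_neq i j : (a ^+ i == b * a ^+ j) = false.
Proof.
apply/negP => /eqP E; move/negP: dih_struct.2; apply.
by rewrite -(mulgK (a ^+ j) b) -E groupM ?groupV ?mem_cycle.
Qed.

Definition el (p : 'I_n * bool) : gT := if p.2 then b * a ^+ p.1 else a ^+ p.1.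

Lemma el_bij : bijective el.
Proof.
have [_ cG _ _ _] := hD.
apply: inj_card_bij; last by rewrite card_prod card_ord card_bool cG mulnC.
have oe (i j : 'I_n) : a ^+ i = a ^+ j -> i = j.
  by move/eqP; rewrite a_eq !modn_small // => /eqP /val_inj.
move=> [i []] [j []]; rewrite /el /=.
- by move/mulgI/oe ->.
- by move/esym/eqP; rewrite ab_neq.
- by move/eqP; rewrite ab_neq.
- by move/oe ->.
Qed.

Lemma elP x : exists k : 'I_n, x = a ^+ k \/ x = b * a ^+ k.
Proof.
have [g _ gK] := el_bij; exists (g x).1; have := gK x; rewrite /el.
by case: (g x).2 => E; [right|left].
Qed.

Lemma sumG (F : gT -> R[i]) : (\sum_x F x =
  \sum_(k < n) F (a ^+ k)%g + \sum_(k < n) F (b * a ^+ k)%g)%R.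
Proof.
rewrite (reindex el); last exact: onW_bij el_bij.
rewrite -(pair_big xpredT xpredT (fun k c => F (el (k, c)))) /= -big_split /=.
by apply: eq_bigr => k _; rewrite big_bool addrC.
Qed.

Local Open Scope ring_scope.
Local Notation w := (omega R n).

(** [phi h eps] is [w^(hk)] at [a^k] and [eps w^(hk)] at [b a^k]; for [eps] a
    sign it is an eigenfunction of left translation by [S]. *)
Definition phi (h : nat) (eps : R[i]) (x : gT) : R[i] :=
  \sum_(k < n | (a ^+ k)%g == x) w ^+ (h * k)
  + eps * \sum_(k < n | (b * a ^+ k)%g == x) w ^+ (h * k).

Lemma wmod h k : w ^+ (h * (k %% n)) = w ^+ (h * k).
Proof.
by apply/eqP; rewrite (eq_prim_root_expr (omega_prim n0)) modnMmr.
Qed.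

Lemma phiA h eps k : phi h eps (a ^+ k)%g = w ^+ (h * k).
Proof.
rewrite /phi (big_pred1 (Ordinal (ltn_pmod k n0))) /=; last first.
  by move=> i; rewrite a_eq (modn_small (ltn_ord i)).
rewrite big_pred0 ?mulr0 ?addr0 ?wmod //.
by move=> i; rewrite eq_sym ab_neq.
Qed.

Lemma phiB h eps k : phi h eps (b * a ^+ k)%g = eps * w ^+ (h * k).
Proof.
rewrite /phi big_pred0 ?add0r; last by move=> i; rewrite ab_neq.
rewrite (big_pred1 (Ordinal (ltn_pmod k n0))) /= ?wmod //.
by move=> i; rewrite (inj_eq (mulgI b)) a_eq (modn_small (ltn_ord i)).
Qed.

Lemma phiM h (e : bool) s y : exists c : bool,
  phi h ((-1) ^+ e) (s * y)%g =
  phi h ((-1) ^+ e) (if c then s ^ b else s)%g * phi h ((-1) ^+ e) y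
  /\ c = (y \notin <[a]>)%g.
Proof.
have ee : (-1) ^+ e * (-1) ^+ e = 1 :> R[i] by rewrite -signr_addb addbb.
have [k sE] := elP s; have [j yE] := elP y.
have /cycleP[l lE] : ((a ^+ k) ^ b \in <[a]>)%g.
  by rewrite conjXg ab groupX // groupV cycle_id.
have bab i : (b * a ^+ i \in <[a]>)%g = false.
  by rewrite groupMr ?mem_cycle // (negbTE dih_struct.2).
exists (y \notin <[a]>)%g; split=> //.
case: yE => ->; rewrite ?mem_cycle ?bab /=.
  case: sE => ->; rewrite ?phiA -?mulgA -?expgD ?phiB ?phiA mulnDr exprD //.
  by rewrite mulrA.
case: sE => ->.
  by rewrite lE mulgA [(_ * b)%g]conjgC lE -mulgA -expgD !phiB !phiA mulnDr
    exprD mulrCA.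
have -> : (b * a ^+ k * (b * a ^+ j) = a ^+ (l + j))%g.
  by rewrite expgD -lE conjgE bV !mulgA.
have -> : ((b * a ^+ k) ^ b = b * a ^+ l)%g by rewrite conjMg lE conjgE mulKg.
by rewrite phiA !phiB mulrACA ee mul1r mulnDr exprD.
Qed.

Variable S : {set gT}.
Hypothesis Sn0 : S != set0.
Hypothesis SV : S = (S^-1)%g.
Hypothesis Snorm : normal_connection_set S.

Lemma SJ s g : ((s ^ g)%g \in S) = (s \in S).
Proof.
have [K KS ->] := Snorm.
have aux t h : t \in cover K -> (t ^ h)%g \in cover K.
  case/bigcupP => B BK tB; apply/bigcupP; exists B => //.
  have /imsetP[z _ E] := subsetP KS _ BK; move: tB; rewrite E.
  case/imsetP => u _ ->; rewrite -conjgM; exact: memJ_class (in_setT _).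
by apply/idP/idP => [/(aux _ g^-1)%g|/aux ->//]; rewrite conjgK.
Qed.

Definition lam h (eps : R[i]) : R[i] := \sum_(s in S) phi h eps s.

Lemma phi_eig h (e : bool) y :
  \sum_(s in S) phi h ((-1) ^+ e) (s * y)%g =
  lam h ((-1) ^+ e) * phi h ((-1) ^+ e) y.
Proof.
rewrite /lam mulr_suml.
have [ya|ya] := boolP (y \in <[a]>)%g.
  by apply: eq_bigr => s _; have [_ [-> ->]] := phiM h e s y; rewrite ya.
rewrite [RHS](reindex_inj (conjg_inj b)).
rewrite (eq_bigl (mem S)); last by move=> s; rewrite SJ.
by apply: eq_bigr => s _; have [_ [-> ->]] := phiM h e s y; rewrite ya.
Qed.

Lemma rotE k : ((a ^+ k)%g \in rotations a S) = ((a ^+ k)%g \in S).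
Proof. by rewrite inE mem_cycle andbT. Qed.

Lemma refE k : ((a ^+ k)%g \in reflections a b S) = ((b * a ^+ k)%g \in S).
Proof. by rewrite inE mem_cycle andbT mem_lcoset bV. Qed.

Lemma lamE h eps : lam h eps =
  eta_sum R n a h (rotations a S) + eps * eta_sum R n a h (reflections a b S).
Proof.
rewrite /lam big_mkcond sumG -!big_mkcond /= /eta_sum mulr_sumr.
congr (_ + _).
  by apply: eq_big => [k|k _]; rewrite ?rotE ?phiA.
by apply: eq_big => [k|k _]; rewrite ?refE ?phiB.
Qed.

Lemma etaE0 (X : {set gT}) : X \subset <[a]>%g -> eta_sum R n a 0 X = #|X|%:R.
Proof.
move=> Xa; rewrite -sum1_card natr_sum /eta_sum [RHS]big_mkcond sumG /=.
rewrite [X in _ + X]big1 ?addr0 -?big_mkcond; first exact: eq_bigr.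
move=> k _; case: ifP => // /(subsetP Xa).
by rewrite groupMr ?mem_cycle // (negbTE dih_struct.2).
Qed.

Lemma discr_entry i j :
  discriminant_mx R[i] (cayley S) i j =
  (cayley S (enum_val i) (enum_val j))%:R / #|S|%:R.
Proof.
have degS x : deg (cayley S) x = #|S|.
  rewrite /deg -(card_imset S (inj_comp (mulIg x) (@invg_inj gT))).
  apply: eq_card => y; rewrite inE; apply/idP/imsetP => [yS|[z zS ->]].
    by exists (x * y^-1)%g => //=; rewrite invMg invgK mulgKV.
  by rewrite /cayley /= invMg invgK mulgA mulgV mul1g.
have symS x y : cayley S x y = cayley S y x.
  by rewrite /cayley [in LHS]SV inE invMg invgK.
have NR q : (boundary_mx R[i] (cayley S) *m shift_mx R[i] (cayley S)) i q =
    if (arc_at q).1 == enum_val i then 1 / sqrtC #|S|%:R else 0.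
  have qA : arc_rev (arc_at q) \in arcs (cayley S).
    by rewrite inE /= symS; have := enum_valP q; rewrite inE.
  rewrite mxE (bigD1 (enum_rank_in qA (arc_rev (arc_at q)))) //= big1 ?addr0.
    by rewrite !mxE /arc_at enum_rankK_in // eqxx mulr1 /= degS.
  move=> p; rewrite !mxE.
  have [E|_ _] := eqVneq (arc_at p) (arc_rev (arc_at q)); last by rewrite mulr0.
  by case/eqP; apply: enum_val_inj; rewrite enum_rankK_in.
rewrite mxE; have [eS|neS] := boolP (cayley S (enum_val i) (enum_val j)).
  have qA : (enum_val i, enum_val j) \in arcs (cayley S) by rewrite inE.
  rewrite (bigD1 (enum_rank_in qA (enum_val i, enum_val j))) //= big1 ?addr0.
    rewrite NR !mxE /arc_at enum_rankK_in //= !eqxx degS !div1r.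
    by rewrite fmorphV /= geC0_conj ?sqrtC_ge0 ?ler0n // -invfM -expr2 sqrtCK.
  move=> q ne; rewrite NR !mxE; case: ifP => [/eqP E1|_]; last by rewrite mul0r.
  case: ifP => [/eqP E2|_]; last by rewrite rmorph0 mulr0.
  case/eqP: ne; apply: enum_val_inj; rewrite enum_rankK_in // -E1 -E2.
  exact: surjective_pairing.
rewrite mul0r big1 // => q _; rewrite NR !mxE.
case: ifP => [/eqP E1|_]; last by rewrite mul0r.
case: ifP => [/eqP E2|_]; last by rewrite rmorph0 mulr0.
by move: neS; rewrite -E1 -E2; have := enum_valP q; rewrite inE => ->.
Qed.

Local Notation d := (#|S|%:R : R[i]).

Lemma d_neq0 : d != 0.
Proof. by rewrite pnatr_eq0 cards_eq0. Qed.

Lemma mul_discr (v : 'rV[R[i]]_#|gT|) j :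
  (v *m discriminant_mx R[i] (cayley S)) 0 j =
  (\sum_(s in S) v 0 (enum_rank (s * enum_val j)%g)) / d.
Proof.
rewrite mxE mulr_suml (reindex _ (onW_bij _ (@enum_rank_bij gT))) /=.
rewrite (reindex_inj (mulIg (enum_val j))) /= [RHS]big_mkcond /=.
apply: eq_bigr => s _; rewrite discr_entry enum_rankK /cayley mulgK.
by case: ifP; rewrite ?mul1r // mul0r mulr0.
Qed.

Lemma eig_fun z : eigenvalue (discriminant_mx R[i] (cayley S)) z <->
  exists2 f : gT -> R[i], (forall y, \sum_(s in S) f (s * y)%g = d * z * f y)
    & exists y, f y != 0.
Proof.
split=> [/eigenvalueP[v Hv v0]|[f Hf [y fy]]].
  exists (fun x => v 0 (enum_rank x)) => [y|].
    have := congr1 (fun u : 'rV_#|gT| => u 0 (enum_rank y)) Hv.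
    rewrite mul_discr enum_rankK mxE => /(canRL (divfK d_neq0)) ->.
    by rewrite mulrC mulrA.
  by have /rV0Pn[i vi] := v0; exists (enum_val i); rewrite enum_valK.
apply/eigenvalueP; exists (\row_i f (enum_val i)).
  apply/rowP => j; rewrite mul_discr !mxE.
  under eq_bigr do rewrite mxE enum_rankK.
  by rewrite Hf -[d * z * _]mulrA [d * _]mulrC mulfK ?d_neq0.
by apply/rV0Pn; exists (enum_rank y); rewrite mxE enum_rankK.
Qed.

Lemma eig_lam z : eigenvalue (discriminant_mx R[i] (cayley S)) z <->
  exists h : 'I_n, exists e : bool, z = lam h ((-1) ^+ e) / d.
Proof.
rewrite eig_fun; split=> [[f Hf [y fy]]|[h [e ->]]]; last first.
  exists (phi h ((-1) ^+ e)) => [y|].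
    by rewrite phi_eig mulrC [d * _]mulrC divfK ?d_neq0 // mulrC.
  by exists 1%g; rewrite -(expg0 a) phiA muln0 expr0 oner_eq0.
have [/existsP[h /existsP[e /eqP->]]|none] :=
    boolP [exists h : 'I_n, exists e : bool, z == lam h ((-1) ^+ e) / d].
  by exists h, e.
have orth (h : 'I_n) (e : bool) : \sum_x f x * phi h ((-1) ^+ e) x = 0.
  set p := phi h _.
  have /eqP : d * z * (\sum_x f x * p x) =
      lam h ((-1) ^+ e) * (\sum_x f x * p x).
    transitivity (\sum_x \sum_(s in S) f (s * x)%g * p x).
      by rewrite mulr_sumr; apply: eq_bigr => x _; rewrite -mulr_suml Hf mulrA.
    rewrite exchange_big /= (reindex_inj invg_inj) /=.
    rewrite (eq_bigl (mem S)); last by move=> s; rewrite /= [in RHS]SV inE.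
    transitivity (\sum_(s in S) \sum_x f x * p (s * x)%g).
      apply: eq_bigr => s _; rewrite (reindex_inj (mulgI s)).
      by apply: eq_bigr => x _; rewrite mulKg.
    rewrite exchange_big /= mulr_sumr; apply: eq_bigr => x _.
    by rewrite -mulr_sumr phi_eig mulrCA.
  rewrite -subr_eq0 -mulrBl mulf_eq0 subr_eq0 => /orP[/eqP E|/eqP //].
  case/negP: none; apply/existsP; exists h; apply/existsP; exists e.
  by rewrite -E mulrC mulKf // d_neq0.
have fG (h : 'I_n) :
    \sum_(k < n) f (a ^+ k)%g * w ^+ (h * k) = 0 /\
    \sum_(k < n) f (b * a ^+ k)%g * w ^+ (h * k) = 0.
  have E (e : bool) : \sum_(k < n) f (a ^+ k)%g * w ^+ (h * k) +
      (-1) ^+ e * \sum_(k < n) f (b * a ^+ k)%g * w ^+ (h * k) = 0.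
    rewrite -[RHS](orth h e) sumG mulr_sumr; congr (_ + _).
      by apply: eq_bigr => k _; rewrite phiA.
    by apply: eq_bigr => k _; rewrite phiB mulrCA.
  have := E false; have := E true; rewrite expr0 expr1 mul1r mulN1r.
  move/subr0_eq => ->; rewrite -mulr2n => /eqP.
  by rewrite -mulr_natr mulf_eq0 pnatr_eq0 orbF => /eqP.
have [k [yE|yE]] := elP y; move: fy; rewrite yE.
  by rewrite (dft_inj (F := fun k => f (a ^+ k)%g)) ?eqxx // => h; case: (fG h).
rewrite (dft_inj (F := fun k => f (b * a ^+ k)%g)) ?eqxx // => h.
by case: (fG h).
Qed.

Variable m : nat.
Hypothesis hn : n = (2 * m)%N.

Lemma eta_ref0 h : (0 < h < n)%N -> h != m ->
  eta_sum R n a h (reflections a b S) = 0.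
Proof.
move=> /andP[h0 hn'] hm; set E := eta_sum _ _ _ _ _.
have w2 : w ^+ (2 * h) != 1.
  rewrite -(prim_order_dvd (omega_prim n0)) hn dvdn_pmul2l //.
  apply/negP => /dvdnP[[|[|c]] Eh].
  - by rewrite Eh in h0.
  - by rewrite Eh mul1n eqxx in hm.
  - by move: hn'; rewrite Eh hn ltn_mul2r ltnNge //= andbF.
have EE : E = \sum_(s in S | s \notin <[a]>%g) phi h 1 s.
  rewrite big_mkcond sumG big1 ?add0r => [|k _]; last by rewrite mem_cycle andbF.
  rewrite -big_mkcond /= /E /eta_sum; apply: eq_big => [k|k _].
    by rewrite refE groupMr ?mem_cycle // dih_struct.2 andbT.
  by rewrite phiB mul1r.
have : w ^+ (2 * h) * E = E.
  rewrite EE [RHS](reindex_inj (conjg_inj a)) mulr_sumr.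
  apply: eq_big => [s|s /andP[_ sa]]; first by rewrite SJ memJ_norm // -cycle_subG normG.
  have [k [sE|sE]] := elP s; first by rewrite sE mem_cycle in sa.
  have -> : (s ^ a = b * a ^+ (2 + k))%g.
    rewrite sE conjgE mulgA [(a^-1 * _)%g]mulgA [(a^-1 * b)%g]conjgC conjVg ab.
    by rewrite invgK -!mulgA -expgSr -expgS.
  by rewrite sE !phiB !mul1r mulnDr exprD [(h * 2)%N]mulnC.
move/eqP; rewrite -[X in _ == X]mul1r -subr_eq0 -mulrBl mulf_eq0 subr_eq0.
by rewrite (negbTE w2) => /eqP.
Qed.

Lemma eta_sym h : (h <= n)%N ->
  eta_sum R n a (n - h) (rotations a S) = eta_sum R n a h (rotations a S).
Proof.
move=> hn'.
have E l : eta_sum R n a l (rotations a S) =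
    \sum_(s in S | s \in <[a]>%g) phi l 1 s.
  rewrite big_mkcond sumG [X in _ + X]big1 ?addr0 => [|k _]; last first.
    by rewrite groupMr ?mem_cycle // (negbTE dih_struct.2) andbF.
  rewrite -big_mkcond /= /eta_sum; apply: eq_big => [k|k _].
    by rewrite rotE mem_cycle andbT.
  by rewrite phiA.
rewrite !E [LHS](reindex_inj invg_inj); apply: eq_big => [s|s /andP[_ sa]].
  by rewrite groupV; congr (_ && _); rewrite [in RHS]SV inE.
have [k [sE|sE]] := elP s; last first.
  by move: sa; rewrite groupV sE groupMr ?mem_cycle // (negbTE dih_struct.2).
have -> : (s^-1 = a ^+ (n - k))%g.
  apply/eqP; rewrite eq_invg_mul sE -expgD subnKC ?(ltnW (ltn_ord k)) //.
  by rewrite -dih_struct.1 expg_order.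
rewrite sE !phiA; apply/eqP; rewrite (eq_prim_root_expr (omega_prim n0)).
rewrite -(eqn_modDr (h * (n - k))) -[X in _ == X %[mod _]]mulnDr.
rewrite -mulnDl subnK // subnKC ?(ltnW (ltn_ord k)) //.
by rewrite modnMr modnMl.
Qed.

Lemma wm : w ^+ m = -1.
Proof.
have m0 : (0 < m)%N by move: n0; rewrite hn muln_gt0.
have : (w ^+ m) ^+ 2 == 1.
  by rewrite -exprM mulnC -hn -(prim_order_dvd (omega_prim n0)).
rewrite sqrf_eq1 -(prim_order_dvd (omega_prim n0)) hn => /orP[|/eqP //].
by move/(dvdn_leq m0); rewrite leqNgt mul2n -addnn -[X in (X < _)%N]addn0 ltn_add2l m0.
Qed.

Lemma eta_m (X : {set gT}) :
  eta_sum R n a m X = (even_count n a X)%:R - (odd_count n a X)%:R.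
Proof.
rewrite /even_count /odd_count /eta_sum -!sum1_card !natr_sum -sumrN.
rewrite !big_mkcond [in RHS]big_mkcond /= [X in _ + X]big_mkcond -big_split /=.
apply: eq_bigr => k _; rewrite !inE exprM wm.
by case: ifP => //=; rewrite ?addr0 // -signr_odd; case: (odd k); rewrite ?add0r ?addr0.
Qed.

Lemma lam01 : lam 0 1 = d.
Proof.
rewrite /lam -sum1_card natr_sum; apply: eq_bigr => s _.
by have [k [->|->]] := elP s; rewrite ?phiA ?phiB mul0n expr0 ?mulr1.
Qed.

Lemma eig_discr z : eigenvalue (discriminant_mx R[i] (cayley S)) z <->
  z \in [:: mut1 R; mut2 R a b S; mut3 R n a b S; mut4 R n a b S]
  \/ exists2 h, (1 <= h <= m.-1)%N & z = mu R n a S h.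
Proof.
have m0 : (0 < m)%N by move: n0; rewrite hn muln_gt0.
have mn : (m < n)%N by rewrite hn mul2n -addnn -[X in (X < _)%N]addn0 ltn_add2l.
have rS : rotations a S \subset <[a]>%g by exact: subsetIr.
have fS : reflections a b S \subset <[a]>%g by exact: subsetIr.
have l1 : lam 0 ((-1) ^+ false) / d = mut1 R by rewrite lam01 divff ?d_neq0.
have l2 : lam 0 ((-1) ^+ true) / d = mut2 R a b S.
  by rewrite lamE !etaE0 // expr1 mulN1r.
have l3 : lam m ((-1) ^+ false) / d = mut3 R n a b S.
  by rewrite lamE !eta_m expr0 mul1r addrA.
have l4 : lam m ((-1) ^+ true) / d = mut4 R n a b S.
  by rewrite lamE !eta_m expr1 mulN1r opprB addrA.
have lh h (e : bool) : (0 < h < n)%N -> h != m ->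
    lam h ((-1) ^+ e) / d = mu R n a S h.
  by move=> h0 hm; rewrite lamE eta_ref0 // mulr0 addr0.
rewrite eig_lam; split=> [[h [e ->]]|].
  have [h0|h0] := posnP h.
    by left; rewrite h0; case: e; rewrite ?l1 ?l2 !inE eqxx ?orbT.
  have [hm|hm|hm] := ltngtP h m.
  - right; exists h; first by rewrite h0 -ltnS prednK.
    by rewrite lh ?h0 ?ltn_ord // ltn_eqF.
  - right; exists (n - h)%N.
      rewrite subn_gt0 ltn_ord /= -ltnS prednK // ltn_subLR ?(ltnW (ltn_ord h)) //.
      by rewrite [X in (X < _)%N]hn mul2n -addnn ltn_add2r.
    rewrite lh ?h0 ?ltn_ord // ?gtn_eqF // /mu eta_sym //.
    exact: ltnW (ltn_ord h).
  - by left; rewrite hm; case: e; rewrite ?l3 ?l4 !inE eqxx ?orbT.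
case=> [|[h /andP[h0 hm] ->]].
  rewrite !inE => /or4P[] /eqP->.
  - by exists (Ordinal n0), false.
  - by exists (Ordinal n0), true.
  - by exists (Ordinal mn), false.
  - by exists (Ordinal mn), true.
have hm' : (h < m)%N by rewrite -(prednK m0) ltnS.
exists (Ordinal (ltn_trans hm' mn)), false.
by rewrite lh //= ?h0 ?(ltn_trans hm' mn) // ltn_eqF.
Qed.
End Spectrum.
End DihedralSpectrum.

Lemma discriminant_eigenvalues (R : realType) (n m : nat) (gT : finGroupType)
    (a b : gT) (S : {set gT}) :
    n = (2 * m)%N -> (4 <= n)%N -> dihedral_pres n a b -> S != set0 ->
    S = (S^-1)%g -> normal_connection_set S ->
  forall z : R[i], eigenvalue (discriminant_mx R[i] (cayley S)) z <->
    z \in [:: mut1 R; mut2 R a b S; mut3 R n a b S; mut4 R n a b S]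
    \/ exists2 h, (1 <= h <= m.-1)%N & z = mu R n a S h.
Proof.
move=> hn n4 hD Sn0 SV Snorm z; have n0 : (0 < n)%N by exact: leq_trans n4.
exact: (DihedralSpectrum.eig_discr n0 hD Sn0 SV Snorm hn).
Qed.

(* Main.v *)
Require Import Defs.
From mathcomp Require Import all_boot all_order all_algebra all_fingroup.
From mathcomp Require Import reals trigo.
From mathcomp Require Import complex zify.

Set Implicit Arguments.
Unset Strict Implicit.
Unset Printing Implicit Defensive.
Import Order.TTheory GRing.Theory Num.Theory.

Local Open Scope ring_scope.

(** Perfect state transfer is a statement about the arc space, but it can be
    read off on the vertices. Since [N N^* = 1] and [R^2 = 1], the sequence
    [U^k N^*] satisfies the Chebyshev recurrence
    [U^(k+2) N^* = 2 U^(k+1) N^* P - U^k N^*], hence [N U^k N^* = T_k(P)]; this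
    is used in the form [groverX_eigen], which evaluates [N U^k N^*] on a left
    eigenvector of [P]. As [U] is an isometry and [Phi_u], [Phi_v] are unit
    vectors, [U^tau Phi_u = g Phi_v] with [g] unimodular is equivalent to its
    image under [N], namely [T_tau(P) e_u = g e_v] ([pst_compress]). Testing
    this against a separating family of left eigenvectors of [P] makes it one
    scalar equation per eigenvector ([pst_spectral]).

    For a normal dihedral Cayley graph such a family is given by the functions
    [phi h eps], for [h < n] and [eps] a sign, worth [w^(hk)] at [a^k] and
    [eps w^(hk)] at [b a^k]. The trivial one, [h = 0] and [eps = 1], has
    eigenvalue 1 and forces [g = 1]. For [h = 1 < m] the two signs share the
    eigenvalue [mu_1]: comparing the two equations puts [u] and [v] in the same
    coset of [<a>]. The frequencies [h = 1] and [h = n - 1] also share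
    [mu_1], so [w^(v - u)] is its own inverse, and [v - u] is a multiple of
    [m]; it is not a multiple of [n] because [u] and [v] differ. Once
    [v - u = m] modulo [n], each equation becomes [T_tau(z) = w^(hm) = (-1)^h]
    at the eigenvalue [z] of [phi h eps] ([pst_dih_elt]), and
    [dih_eigval_chebyshev] lists these conditions over the distinct
    eigenvalues. Conversely, these conditions give back every equation, with
    [g = 1]. *)

(** * Chebyshev polynomials *)

Lemma chebyshevSS (A : nzRingType) k :
  chebyshev A k.+2 = 'X *+ 2 * chebyshev A k.+1 - chebyshev A k.
Proof. by rewrite /chebyshev /=; case: (chebyshev_pair A k). Qed.

Lemma chebyshev_at1 (A : comNzRingType) k : (chebyshev A k).[1] = 1.
Proof.
suff [] : (chebyshev A k).[1] = 1 /\ (chebyshev A k.+1).[1] = 1 by [].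
elim: k => [|k [IHk IHk1]]; first by rewrite /chebyshev /= !hornerE.
by split=> //; rewrite chebyshevSS !hornerE IHk IHk1 !mulr1 addrK.
Qed.

(** * Compression of the Grover walk to the vertices *)

Section GroverWalk.

Local Open Scope sesquilinear_scope.

Variables (C : numClosedFieldType) (V : finType) (e : rel V).
Hypothesis e_sym : symmetric e.
Hypothesis deg_gt0 : forall u, (0 < deg e u)%N.

Local Notation N := (boundary_mx C e).
Local Notation U := (grover_mx C e).
Local Notation Sh := (shift_mx C e).
Local Notation P := (discriminant_mx C e).

Lemma sum_arcs (F : V * V -> C) :
  \sum_(k < #|arcs e|) F (arc_at k) = \sum_(x in arcs e) F x.
Proof. symmetry; exact: (@big_enum_val _ _ _ _ (mem (arcs e)) F). Qed.

Lemma in_degE u : #|[set x in arcs e | x.2 == u]| = deg e u.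
Proof.
have inj_arc : injective (fun v : V => (v, u)) by move=> v w [].
rewrite /deg -[RHS](card_imset _ inj_arc).
apply: eq_card => -[x y]; rewrite !inE /=.
apply/andP/imsetP => [[exy /eqP <-]|[v + [-> ->]]]; last by rewrite inE e_sym.
by exists x; rewrite // inE e_sym.
Qed.

(** The rows of [N] have disjoint supports, and [deg u] arcs point to [u], so
    the weight [1 / sqrt (deg u)] makes each row a unit vector. *)
Lemma boundary_coisometry : N *m N^t* = 1%:M.
Proof.
apply/matrixP => i j; rewrite [RHS]mxE mxE.
pose c (k : 'I_#|V|) : C := 1 / sqrtC (deg e (enum_val k))%:R.
pose F (x : V * V) := (if x.2 == enum_val i then c i else 0) *
            (if x.2 == enum_val j then c j else 0)^*.
transitivity (\sum_(k < #|arcs e|) F (arc_at k)).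
  by apply: eq_bigr => k _; rewrite !mxE.
rewrite sum_arcs; have [ij|ne] := eqVneq i j.
  have -> : \sum_(x in arcs e) F x =
            \sum_(x in [set x in arcs e | x.2 == enum_val j]) (c j * (c j)^*).
    rewrite [LHS]big_mkcond [RHS]big_mkcond; apply: eq_bigr => x _.
    by rewrite !inE /F ij; case: (e _ _) => //=; case: ifP; rewrite ?mul0r.
  rewrite sumr_const in_degE /c div1r fmorphV /= geC0_conj ?sqrtC_ge0 ?ler0n //.
  by rewrite -invfM -expr2 sqrtCK -[LHS]mulr_natr mulVf // pnatr_eq0 -lt0n.
rewrite big1 // => x _; rewrite /F; case: ifP => [/eqP ->|]; last by rewrite mul0r.
by rewrite (inj_eq enum_val_inj) (negbTE ne) rmorph0 mulr0.
Qed.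

Lemma arc_revK : involutive (@arc_rev V).
Proof. by case. Qed.

Lemma shift_invol : Sh *m Sh = 1%:M.
Proof.
apply/matrixP => i j; rewrite [RHS]mxE mxE.
pose F (x : V * V) : C := (if arc_at i == arc_rev x then 1 else 0) *
                (if x == arc_rev (arc_at j) then 1 else 0).
transitivity (\sum_(k < #|arcs e|) F (arc_at k)).
  by apply: eq_bigr => k _; rewrite !mxE.
have rev_j : arc_rev (arc_at j) \in arcs e.
  by rewrite inE /= e_sym; have := enum_valP j; rewrite inE.
rewrite sum_arcs (bigD1 _ rev_j) big1 /= => [|x /andP[_ /negbTE nx]].
  by rewrite /F arc_revK eqxx mulr1 addr0 (inj_eq enum_val_inj); case: eqP.
by rewrite /F nx mulr0.
Qed.

Lemma shift_adj : Sh^t* = Sh.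
Proof.
apply/matrixP => i j; rewrite !mxE -(inv_eq arc_revK) eq_sym.
by case: eqP => _; rewrite ?rmorph1 ?rmorph0.
Qed.

Lemma adjM (m n p : nat) (X : 'M[C]_(m, n)) (Y : 'M[C]_(n, p)) :
  (X *m Y)^t* = Y^t* *m X^t*.
Proof. by rewrite trmx_mul map_mxM. Qed.

Lemma adjK (m n : nat) (X : 'M[C]_(m, n)) : (X^t*)^t* = X.
Proof. by apply/matrixP => i j; rewrite !mxE conjCK. Qed.

(** [N^* N] is a projection, so [2 N^* N - 1] is a self-adjoint involution, and
    [R] is one as well. *)
Lemma grover_isometry : U^t* *m U = 1%:M.
Proof.
rewrite /grover_mx; set K := _ - 1%:M.
have KE : K = 2 *: (N^t* *m N) - 1%:M by [].
have K_adj : K^t* = K.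
  by rewrite KE linearB linearZ /= map_mxB map_mxZ adjM adjK trmx1 map_mx1
     rmorph_nat.
rewrite adjM shift_adj K_adj mulmxA -(mulmxA K) shift_invol mulmx1.
set Q := N^t* *m N in KE; rewrite scaler_nat mulr2n in KE.
have QQ : Q *m Q = Q.
  by rewrite /Q mulmxA -(mulmxA (N^t*)) boundary_coisometry mulmx1.
have KQ : K *m Q = Q by rewrite KE mulmxBl mulmxDl QQ mul1mx addrK.
by rewrite {2}KE mulmxBr mulmxDr KQ mulmx1 KE subKr.
Qed.

Lemma groverX_isometry k : (U ^+ k)^t* *m U ^+ k = 1%:M.
Proof.
elim: k => [|k IHk]; first by rewrite expr0 trmx1 map_mx1 mulmx1.
rewrite exprSr -mulmxE adjM mulmxA -(mulmxA (U^t*)) IHk mulmx1.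
exact: grover_isometry.
Qed.

Lemma grover_boundary : U *m N^t* = Sh *m N^t*.
Proof.
rewrite /grover_mx -mulmxA mulmxBl mul1mx -scalemxAl -mulmxA.
by rewrite boundary_coisometry mulmx1 scaler_nat mulr2n addrK.
Qed.

(** The span of the images of [N^*] and [R N^*] is stable under [U]:
    [U N^* = R N^*] and [U R N^* = 2 R N^* P - N^*]. *)
Lemma groverX_recurrence k :
  U ^+ k.+2 *m N^t* = (U ^+ k.+1 *m N^t* *m P) *+ 2 - U ^+ k *m N^t*.
Proof.
have U2 : U *m (U *m N^t*) = (U *m N^t* *m P) *+ 2 - N^t*.
  rewrite grover_boundary {1}/grover_mx /discriminant_mx.
  rewrite -mulmxA mulmxBl mul1mx mulmxBr !mulmxA shift_invol mul1mx.
  by rewrite -scalemxAr -!scalemxAl scaler_nat !mulmxA.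
move: U2; generalize U P => W Q U2.
rewrite !exprSr -!mulmxE -!mulmxA U2 mulmxBr; congr (_ - _).
by rewrite raddfMn /= !mulmxA.
Qed.

(** This is [N U^k N^* = T_k(P)], tested on a left eigenvector so that [T_k] is
    only evaluated at scalars. *)
Lemma groverX_eigen (x : 'rV_#|V|) (z : C) k :
  x *m P = z *: x -> x *m (N *m (U ^+ k *m N^t*)) = (chebyshev C k).[z] *: x.
Proof.
move=> xP; pose y k := x *m (N *m (U ^+ k *m N^t*)).
suff [] : y k = (chebyshev C k).[z] *: x /\ y k.+1 = (chebyshev C k.+1).[z] *: x
  by [].
elim: k => [|k [IHk IHk1]].
  rewrite /y expr0 mul1mx boundary_coisometry mulmx1 /chebyshev /= !hornerE.
  by rewrite scale1r expr1 grover_boundary -xP /discriminant_mx !mulmxA.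
split=> //; rewrite /y groverX_recurrence !mulmxBr -/(y k) IHk chebyshevSS.
rewrite !hornerE scalerBl; congr (_ - _).
rewrite !raddfMn /= (mulmxA N) (mulmxA x) -/(y k.+1) IHk1 -scalemxAl xP.
by rewrite scalerA mulrC mulr2n -scalerDl -mulrDl.
Qed.

Lemma adj_mul_eq0 n (x : 'cV[C]_n) : x^t* *m x = 0 -> x = 0.
Proof.
move/matrixP/(_ 0 0); rewrite !mxE => /eqP.
rewrite psumr_eq0 => [/allP x0|i _]; last by rewrite !mxE mulrC mul_conjC_ge0.
apply/colP => i; have := x0 i (mem_index_enum i); rewrite !mxE /= mulrC.
by rewrite mul_conjC_eq0 => /eqP.
Qed.

(** The converse is the equality case of Cauchy-Schwarz: if [x] and [y] are unit
    vectors and [y^* x = g] with [|g| = 1], then [|x - g y|^2 = 0]. Here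
    [x = U^tau Phi_u] and [y = Phi_v], and [y^* x] is the [v]-th entry of
    [N x]. *)
Lemma pst_compress u v tau : pst C e u v tau <->
  [/\ v != u, (0 < tau)%N & exists2 g : C, `|g| = 1 &
    N *m (U ^+ tau *m N^t*) *m delta_mx (enum_rank u) 0 =
    g *: delta_mx (enum_rank v) (0 : 'I_1)].
Proof.
split=> -[vu tau0 [g g1 Eg]]; split=> //; exists g => //.
  rewrite -2!mulmxA Eg -scalemxAr /vertex_state mulmxA boundary_coisometry.
  by rewrite mul1mx.
set x := U ^+ tau *m _; set y := vertex_state C e v.
pose dl w : 'cV[C]_#|V| := delta_mx (enum_rank w) 0.
have dlP w : (dl w)^t* *m dl w = 1%:M.
  apply/matrixP => i j; rewrite !ord1 !mxE (bigD1 (enum_rank w)) //= big1.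
    by rewrite !mxE !eqxx rmorph1 mulr1 addr0.
  by move=> k /negbTE ne; rewrite !mxE ne /= mulr0.
have stateP w : (vertex_state C e w)^t* *m vertex_state C e w = 1%:M.
  rewrite /vertex_state adjM adjK mulmxA -(mulmxA _ N) boundary_coisometry.
  by rewrite mulmx1 dlP.
have xx : x^t* *m x = 1%:M.
  by rewrite /x adjM mulmxA -(mulmxA _ _ (U ^+ tau)) groverX_isometry mulmx1.
have gg : g^* * g = 1 by rewrite mulrC -normCK g1 expr1n.
have yx : y^t* *m x = g%:M.
  rewrite /y /vertex_state adjM adjK -mulmxA /x /vertex_state.
  rewrite (mulmxA (U ^+ tau)) (mulmxA N) Eg -scalemxAr dlP.
  by rewrite scalemx1.
have xy : x^t* *m y = (g^*)%:M.
  by rewrite -[LHS]adjK adjM adjK yx; apply/matrixP=> i j; rewrite !ord1 !mxE.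
apply/subr0_eq/adj_mul_eq0.
have -> : (x - g *: y)^t* = x^t* - g^* *: y^t*.
  by rewrite linearB linearZ /= map_mxB map_mxZ.
rewrite mulmxBl !mulmxBr.
rewrite -!scalemxAl -!scalemxAr xx xy yx stateP.
by rewrite !scale_scalar_mx mulr1 [g * _]mulrC gg !subrr.
Qed.

(** A column vector is determined by its pairings with a separating family, and
    [T_tau(P)] acts on each [x i] by a scalar. *)
Lemma pst_spectral (I : Type) (x : I -> 'rV_#|V|) (z : I -> C) u v tau :
    (forall i, x i *m P = z i *: x i) ->
    (forall c : 'cV_#|V|, (forall i, x i *m c = 0) -> c = 0) ->
  pst C e u v tau <->
  [/\ v != u, (0 < tau)%N & exists2 g : C, `|g| = 1 &
    forall i, (chebyshev C tau).[z i] * x i 0 (enum_rank u) =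
              g * x i 0 (enum_rank v)].
Proof.
move=> xP x_sep; rewrite pst_compress.
have xE i g : x i *m (N *m (U ^+ tau *m N^t*) *m delta_mx (enum_rank u) 0) =
        x i *m (g *: delta_mx (enum_rank v) (0 : 'I_1)) <->
    (chebyshev C tau).[z i] * x i 0 (enum_rank u) = g * x i 0 (enum_rank v).
  rewrite mulmxA (groverX_eigen tau (xP i)) -scalemxAl -scalemxAr -!colE.
  split=> [/matrixP/(_ 0 0)|E]; first by rewrite !mxE.
  by apply/matrixP => j k; rewrite !ord1 !mxE.
split=> -[vu tau0 [g g1 Eg]]; split=> //; exists g => //.
  by move=> i; apply/xE; rewrite Eg.
apply/subr0_eq/x_sep => i; apply/eqP; rewrite mulmxBr subr_eq0; apply/eqP.
exact/xE.
Qed.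

End GroverWalk.

(** * Spectral test on a normal dihedral Cayley graph *)

Section DihedralTransfer.

Import DihedralSpectrum.

Variables (R : realType) (n m : nat) (gT : finGroupType) (a b : gT).
Variable S : {set gT}.
Hypotheses (hn : n = (2 * m)%N) (hn4 : (4 <= n)%N).
Hypothesis hD : dihedral_pres n a b.
Hypotheses (hS0 : S != set0) (hSV : S = (S^-1)%g).
Hypothesis hnormal : normal_connection_set S.

Let n_gt0 : (0 < n)%N. Proof. exact: leq_trans hn4. Qed.

Local Notation w := (omega R n).
Local Notation P := (discriminant_mx R[i] (cayley S)).

Definition dih_eigval (h : nat) (e : bool) : R[i] :=
  lam n a b S h ((-1) ^+ e) / #|S|%:R.

Definition dih_eigrow (h : nat) (e : bool) : 'rV[R[i]]_#|gT| :=
  \row_i phi n a b h ((-1) ^+ e) (enum_val i).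

Lemma cayley_sym : symmetric (cayley S).
Proof. by move=> x y; rewrite /cayley [in LHS]hSV inE invMg invgK. Qed.

Lemma cayley_deg_gt0 x : (0 < deg (cayley S) x)%N.
Proof.
have /set0Pn[s sS] := hS0; apply/card_gt0P; exists (s^-1 * x)%g.
by rewrite inE /cayley invMg invgK mulgA mulgV mul1g.
Qed.

Lemma card_S_neq0 : #|S|%:R != 0 :> R[i].
Proof. by rewrite pnatr_eq0 cards_eq0. Qed.

Lemma dih_eigrowP h e : dih_eigrow h e *m P = dih_eigval h e *: dih_eigrow h e.
Proof.
apply/rowP => j; rewrite mul_discr // !mxE.
under eq_bigr do rewrite mxE enum_rankK.
by rewrite phi_eig // mulrAC.
Qed.

(** The sum and the difference of the equations for the two signs isolate the
    Fourier coefficients of [c] on each coset of [<a>], and the discrete Fourier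
    transform is injective. *)
Lemma dih_eigrow_separate (c : 'cV[R[i]]_#|gT|) :
  (forall i : 'I_n * bool, dih_eigrow i.1 i.2 *m c = 0) -> c = 0.
Proof.
move=> c0; pose f x := c (enum_rank x) 0.
have orth (h : 'I_n) (e : bool) :
    \sum_(k < n) f (a ^+ k)%g * w ^+ (h * k) +
    (-1) ^+ e * \sum_(k < n) f (b * a ^+ k)%g * w ^+ (h * k) = 0.
  have := congr1 (fun M : 'M_1 => M 0 0) (c0 (h, e)); rewrite !mxE /=.
  rewrite (reindex _ (onW_bij _ (@enum_rank_bij gT))) /= (sumG n_gt0 hD) => E.
  rewrite -[RHS]E mulr_sumr; congr (_ + _); apply: eq_bigr => k _.
    by rewrite mxE enum_rankK phiA // mulrC.
  by rewrite mxE enum_rankK phiB // -mulrA [in RHS](mulrC (w ^+ _)).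
have f0 (h : 'I_n) : \sum_(k < n) f (a ^+ k)%g * w ^+ (h * k) = 0 /\
    \sum_(k < n) f (b * a ^+ k)%g * w ^+ (h * k) = 0.
  have := orth h false; have := orth h true.
  rewrite expr0 expr1 mul1r mulN1r => /subr0_eq ->.
  rewrite -mulr2n => /eqP; rewrite -mulr_natr mulf_eq0 pnatr_eq0 orbF.
  by move/eqP.
apply/colP => i; rewrite mxE -(enum_valK i) -/(f _).
have [k [->|->]] := elP n_gt0 hD (enum_val i).
  by apply: (dft_inj (F := fun k => f (a ^+ k)%g)) => h; case: (f0 h).
by apply: (dft_inj (F := fun k => f (b * a ^+ k)%g)) => h; case: (f0 h).
Qed.

Lemma dih_eigval01 : dih_eigval 0 false = 1.
Proof. by rewrite /dih_eigval lam01 // divff ?card_S_neq0. Qed.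

(** The phase is 1 because the constant function has eigenvalue 1, where every
    [T_tau] takes the value 1. *)
Lemma pst_dih_eigrow x y tau : pst R[i] (cayley S) x y tau <->
  [/\ y != x, (0 < tau)%N & forall (h : 'I_n) (e : bool),
    (chebyshev R[i] tau).[dih_eigval h e] * phi n a b h ((-1) ^+ e) x =
    phi n a b h ((-1) ^+ e) y].
Proof.
rewrite (pst_spectral cayley_sym cayley_deg_gt0 _ _ _
  (fun i : 'I_n * bool => dih_eigrowP i.1 i.2) dih_eigrow_separate).
split=> -[yx tau0 H]; split=> //; last first.
  exists 1; first exact: normr1.
  by move=> [h e]; rewrite !mxE !enum_rankK mul1r H.
case: H => g _ H.
have phi0 z : phi n a b 0 1 z = 1 :> R[i].
  by have [k [->|->]] := elP n_gt0 hD z; rewrite ?phiA ?phiB // mul0n ?mulr1.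
have g1 : g = 1.
  have := H (Ordinal n_gt0, false).
  by rewrite !mxE !enum_rankK dih_eigval01 chebyshev_at1 !phi0 !mulr1.
by move=> h e; have := H (h, e); rewrite !mxE !enum_rankK g1 mul1r.
Qed.

(** Away from [h = 0] and [h = m] the reflections contribute nothing, so the
    eigenvalue does not see the sign. *)
Lemma dih_eigval_mu h e : (0 < h < n)%N -> h != m ->
  dih_eigval h e = mu R n a S h.
Proof. by move=> h0 hm; rewrite /dih_eigval lamE // (eta_ref0 R n_gt0 hD hnormal hn) // mulr0 addr0. Qed.

Lemma mu_sym h : (h <= n)%N -> mu R n a S (n - h) = mu R n a S h.
Proof. by move=> hle; rewrite /mu (eta_sym R n_gt0 hD hSV hle). Qed.

(** The linear characters are the four functions with [h = 0] or [h = m]. The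
    other frequencies come in pairs [h], [n - h] with a common eigenvalue, and
    [(-1)^h] is the same for both because [n] is even. *)
Lemma dih_eigval_chebyshev tau :
  (forall (h : 'I_n) (e : bool),
     (chebyshev R[i] tau).[dih_eigval h e] = (-1) ^+ h) <->
  [/\ (chebyshev R[i] tau).[mut1 R] = 1,
      (chebyshev R[i] tau).[mut2 R a b S] = 1,
      (chebyshev R[i] tau).[mut3 R n a b S] = (-1) ^+ m
    & (chebyshev R[i] tau).[mut4 R n a b S] = (-1) ^+ m] /\
  (forall h : nat, (1 <= h <= m.-1)%N ->
     (chebyshev R[i] tau).[mu R n a S h] = (-1) ^+ h).
Proof.
have rot_sub : rotations a S \subset <[a]>%g by exact: subsetIr.
have ref_sub : reflections a b S \subset <[a]>%g by exact: subsetIr.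
have l2 : dih_eigval 0 true = mut2 R a b S.
  by rewrite /dih_eigval lamE // !(etaE0 R n_gt0 hD) // expr1 mulN1r.
have l3 : dih_eigval m false = mut3 R n a b S.
  by rewrite /dih_eigval lamE // !(eta_m _ _ n_gt0 hn) expr0 mul1r addrA.
have l4 : dih_eigval m true = mut4 R n a b S.
  by rewrite /dih_eigval lamE // !(eta_m _ _ n_gt0 hn) expr1 mulN1r opprB addrA.
split=> [H|[[H1 H2 H3 H4] Hmu] h e].
  have hm : (m < n)%N by lia.
  split=> [|h h1].
    rewrite -l2 -l3 -l4.
    by split; [exact: chebyshev_at1|exact: (H (Ordinal n_gt0))
              |exact: (H (Ordinal hm))|exact: (H (Ordinal hm))].
  have hlt : (h < n)%N by lia.
  rewrite -(dih_eigval_mu false); [exact: (H (Ordinal hlt))|lia|lia].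
have [h0|h0] := posnP h.
  by rewrite h0; case: e; rewrite ?l2 ?dih_eigval01.
have [hm|hm|->] := ltngtP h m; last by case: e; rewrite ?l3 ?l4.
  by rewrite dih_eigval_mu ?Hmu //; have := ltn_ord h; lia.
have hlt := ltn_ord h.
rewrite dih_eigval_mu; [|lia|lia].
rewrite -mu_sym ?Hmu; [|lia|lia].
rewrite -signr_odd -[RHS]signr_odd oddB ?(ltnW hlt) //.
have -> : odd n = false by rewrite hn oddM.
by rewrite addFb.
Qed.

(** * Location of the target vertex *)

Definition dih_elt (c : bool) (k : nat) : gT :=
  if c then (b * a ^+ k)%g else (a ^+ k)%g.

Lemma phi_elt h eps c k :
  phi n a b h eps (dih_elt c k) = eps ^+ c * w ^+ (h * k).
Proof. by case: c; rewrite /dih_elt ?phiA ?phiB ?expr0 ?expr1 ?mul1r. Qed.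

Lemma omega_half h k : w ^+ (h * (k + m)) = (-1) ^+ h * w ^+ (h * k).
Proof. by rewrite mulnDr exprD mulrC [(h * m)%N]mulnC exprM (wm R n_gt0 hn). Qed.

Lemma omega_neq0 k : w ^+ k != 0.
Proof.
apply/expf_neq0/eqP => w0; have /eqP := prim_expr_order (omega_prim R n_gt0).
by rewrite w0 expr0n eqn0Ngt n_gt0 eq_sym oner_eq0.
Qed.

Lemma dih_elt_inj c k c' k' : (k < n)%N -> (k' < n)%N ->
  dih_elt c k = dih_elt c' k' -> c = c' /\ k = k'.
Proof.
move=> kn kn'; case: c; case: c'; rewrite /dih_elt.
- by move/mulgI/eqP; rewrite (a_eq n_gt0 hD) !modn_small // => /eqP.
- by move/esym/eqP; rewrite (ab_neq n_gt0 hD).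
- by move/eqP; rewrite (ab_neq n_gt0 hD).
- by move/eqP; rewrite (a_eq n_gt0 hD) !modn_small // => /eqP.
Qed.

(** From left to right, [h = 1] and [h = n - 1] locate the target; this is
    where [4 <= n] enters, as [h = 1] must differ from [m]. *)
Lemma pst_dih_elt c k c' k' tau :
    (0 < tau)%N -> (k < n)%N -> (k' < n)%N ->
  pst R[i] (cayley S) (dih_elt c k) (dih_elt c' k') tau <->
  [/\ c = c', k' = (k + m)%N \/ k = (k' + m)%N & forall (h : 'I_n) (e : bool),
     (chebyshev R[i] tau).[dih_eigval h e] = (-1) ^+ h].
Proof.
move=> tau0 kn kn'; rewrite pst_dih_eigrow; split=> [[ne _ H]|[<- kk H]]; last first.
  split=> // [|h e].
    by apply/eqP => /(dih_elt_inj kn' kn)[_]; lia.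
  rewrite H !phi_elt mulrCA; congr (_ * _).
  by case: kk => ->; rewrite omega_half ?mulrA -?expr2 ?sqrr_sign ?mul1r.
have n1 : (1 < n)%N by lia.
have nn1 : (n.-1 < n)%N by lia.
pose t := (chebyshev R[i] tau).[mu R n a S 1].
have H1 (e : bool) : t * (((-1) ^+ e) ^+ c * w ^+ k) = ((-1) ^+ e) ^+ c' * w ^+ k'.
  have := H (Ordinal n1) e; rewrite !phi_elt !mul1n /=.
  by rewrite dih_eigval_mu //; lia.
have H2 : t * w ^+ (n.-1 * k) = w ^+ (n.-1 * k').
  have := H (Ordinal nn1) false; rewrite !phi_elt !expr0 !expr1n !mul1r /=.
  rewrite dih_eigval_mu; [|lia|lia].
  by rewrite -subn1 mu_sym.
have tk : t * w ^+ k = w ^+ k' by have := H1 false; rewrite !expr0 !expr1n !mul1r.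
(* The two signs share the eigenvalue, so only the coset can tell them apart. *)
have cc : c = c'.
  have := H1 true; rewrite mulrCA tk => /(mulIf (omega_neq0 _)).
  by rewrite !expr1 => /eqP; rewrite (inj_eq signr_inj) => /eqP.
have wn l : w ^+ (n.-1 * l) * w ^+ l = 1.
  by rewrite -exprD -mulSnr prednK // exprM (prim_expr_order (omega_prim R n_gt0))
    expr1n.
(* As [w^n = 1], [h = n - 1] gives [t w^(-k) = w^(-k')]; multiply both sides by
   [w^(k + k')]. *)
have tk' : t * w ^+ k' = w ^+ k.
  have /(congr1 (fun z => z * w ^+ k * w ^+ k')) := H2.
  by rewrite -[t * _ * _]mulrA wn mulr1 => ->; rewrite mulrAC wn mul1r.
have kk : k' = (k + m)%N \/ k = (k' + m)%N.
  have /eqP : w ^+ (2 * k) = w ^+ (2 * k').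
    by rewrite !mul2n -!addnn !exprD -{1}tk' mulrAC tk.
  rewrite (eq_prim_root_expr (omega_prim R n_gt0)) hn -!muln_modr.
  have nek : k != k' by apply: contra_neq ne => ->; rewrite cc.
  have modm l : (l < n)%N -> (l %% m)%N = if (l < m)%N then l else (l - m)%N.
    move=> ln; case: ltnP => [/modn_small //|ml].
    by rewrite -{1}(subnK ml) modnDr modn_small //; lia.
  by rewrite !modm // => /eqP; case: (ltnP k m); case: (ltnP k' m); lia.
split=> // h e; have := H h e; rewrite !phi_elt -cc.
have nz l : ((-1) ^+ e) ^+ c * w ^+ l != 0 :> R[i].
  by rewrite mulf_neq0 ?omega_neq0 // -exprM expf_neq0 // oppr_eq0 oner_eq0.
case: kk => ->; rewrite omega_half.
  by rewrite [RHS]mulrCA => /(mulIf (nz _)) ->.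
rewrite (mulrCA (_ ^+ c) (_ ^+ h)) [_.[_] * _]mulrA -[X in _ = X -> _]mul1r.
move=> /(mulIf (nz _)) ts.
have := congr1 (fun z => z * (-1) ^+ h) ts.
by rewrite /= mul1r -mulrA -expr2 sqrr_sign mulr1.
Qed.

End DihedralTransfer.

(** * Perfect state transfer in terms of the vertex labels *)

Theorem theorem4p4 (R : realType) (n m : nat) (gT : finGroupType) (a b : gT)
    (S : {set gT})
    (hn : n = (2 * m)%N) (hn4 : (4 <= n)%N)
    (hD : dihedral_pres n a b)
    (hS0 : S != set0) (hS1 : (1%g : gT) \notin S) (hSV : S = (S^-1)%g)
    (hnormal : normal_connection_set S)
    (u v : 'I_(2 * n)) (tau : nat) (htau : (0 < tau)%N) :
  pst R[i] (cayley S) (dihedral_vertex a b u) (dihedral_vertex a b v) tau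
  <->
  [/\ ((u < n)%N /\ (v < n)%N) \/ ((n <= u)%N /\ (n <= v)%N),
      (u%:Z - v%:Z = m%:Z) \/ (u%:Z - v%:Z = - m%:Z),
      [/\ (chebyshev R[i] tau).[mut1 R] = 1,
          (chebyshev R[i] tau).[mut2 R a b S] = 1,
          (chebyshev R[i] tau).[mut3 R n a b S] = (-1) ^+ m
        & (chebyshev R[i] tau).[mut4 R n a b S] = (-1) ^+ m]
    & forall h : nat, (1 <= h <= m.-1)%N ->
        (chebyshev R[i] tau).[mu R n a S h] = (-1) ^+ h].
Proof.
pose pos (x : 'I_(2 * n)) := if (x < n)%N then nat_of_ord x else (x - n)%N.
have pos_lt x : (pos x < n)%N.
  by rewrite /pos; case: (ltnP x n) => // le_nx; have := ltn_ord x; lia.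
have vertexE x : dihedral_vertex a b x = dih_elt a b (n <= x)%N (pos x).
  by rewrite /dihedral_vertex /dih_elt /pos ltnNge; case: leqP.
rewrite !vertexE (pst_dih_elt R hn) //.
have cheb_iff := dih_eigval_chebyshev R hn hn4 hD hS0 hSV hnormal tau.
have coset_iff : (n <= u)%N = (n <= v)%N <->
    ((u < n)%N /\ (v < n)%N) \/ ((n <= u)%N /\ (n <= v)%N).
  by case: (leqP n u); case: (leqP n v); intuition.
have half_iff : (n <= u)%N = (n <= v)%N ->
    (pos v = (pos u + m)%N \/ pos u = (pos v + m)%N) <->
    (u%:Z - v%:Z = m%:Z) \/ (u%:Z - v%:Z = - m%:Z).
  by rewrite /pos; case: (leqP n u); case: (leqP n v) => //; lia.
split=> [[cc kk /cheb_iff[H1 H2]]|[cc kk H1 H2]].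
  by split=> //; [exact/coset_iff | exact/half_iff].
split.
- exact/coset_iff.
- by apply/half_iff => //; apply/coset_iff.
- exact/cheb_iff.
Qed.
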